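(* Let $A$, $\Omega=\bigcup_{i=1}^m\Omega_i$, $\mathcal{E}$, $W$, $M$, $\widehat{A}$ be as defined in the context, and assume that $A$ and $-W$ are symmetric positive definite. Let $\Lambda\subset\mathbb{R}^{\mathcal{E}}$ be a subspace with $\dim(\Lambda)=r$, let $Z\in\mathbb{R}^{|\mathcal{E}|\times r}$ satisfy $\mathrm{range}(Z)=\Lambda$, and let $$Q:=\begin{pmatrix}\frac14\widehat{A} & M^TWZ\\ Z^TWM & -Z^TWZ\end{pmatrix},$$ acting on vectors $(p,\eta)\in\mathbb{R}^\Omega\times\mathbb{R}^r$. Then the Schur complement of $Q$ associated with the elimination of $\eta$ is positive definite. Consequently, for $f\in\mathbb{R}^\Omega$, the reduced system for $p$ obtained by eliminating $\eta$ from $Q\begin{pmatrix}p\\ \eta\end{pmatrix}=\begin{pmatrix}\frac14f\\ 0\end{pmatrix}$ can be written equivalently as $$\mathcal{M}p=f,\qquad \mathcal{M}=\widehat{A}+4M^TWZ\left(Z^TWZ\right)^{-1}Z^TWM.$$ In particular, $\mathcal{M}$ is symmetric positive definite.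
   Context: Let $A=(a_{kl})\in\mathbb{R}^{N\times N}$ be a symmetric matrix, with rows and columns indexed by $\Omega=\{1,\dots,N\}$. Let $\Omega=\bigcup_{i=1}^m\Omega_i$ be a partition into $m$ pairwise disjoint subsets (subdomains), with the indices ordered so that those of $\Omega_1,\Omega_2,\dots,\Omega_m$ are consecutive. $A_{ij}$ denotes the submatrix of $A$ with rows in $\Omega_i$ and columns in $\Omega_j$; for $i\ne j$ write $i\sim j$ if $A_{ij}\neq0$. For finite sets $X,Y$, $\mathbb{R}^X$ denotes real vectors indexed by $X$ and $\mathbb{R}^{X\times Y}$ real matrices with rows indexed by $X$ and columns by $Y$. Interface edges: $\mathcal{E}$ is the set of pairs $(k,l)$ with $k\in\Omega_i$, $l\in\Omega_j$ for some $i<j$ and $a_{kl}\ne0$. $W\in\mathbb{R}^{\mathcal{E}\times\mathcal{E}}$ is the diagonal matrix with entry $a_{kl}$ at $e=(k,l)\in\mathcal{E}$. The averaging matrix $M\in\mathbb{R}^{\mathcal{E}\times\Omega}$ is given by $(Mp)_e=\frac{p_k+p_l}{2}$ for $e=(k,l)\in\mathcal{E}$, $p\in\mathbb{R}^\Omega$. For $i\sim j$ let $D_{ij}=\mathrm{diag}(A_{ij}\mathbf{1}_{\Omega_j})$ (diagonal matrix indexed by $\Omega_i$ whose $k$-th diagonal entry is $\sum_{l\in\Omega_j}a_{kl}$), let $A_i=A_{ii}-\sum_{j:\,j\sim i}D_{ij}$, and let $\widehat{A}=\mathrm{diag}(A_1,\dots,A_m)\in\mathbb{R}^{\Omega\times\Omega}$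 (block diagonal). For a block matrix $\begin{pmatrix} E & F \\ F^T & G \end{pmatrix}$ with $G$ invertible, the Schur complement associated with elimination of the second block variable is $E-FG^{-1}F^T$. *)

(* Defs.v *)
From HB Require Import structures.
From mathcomp Require Import all_boot all_order all_algebra.

Set Implicit Arguments.
Unset Strict Implicit.
Unset Printing Implicit Defensive.

Import Order.TTheory GRing.Theory Num.Theory.
Local Open Scope ring_scope.

Definition posdefmx (R : realFieldType) (n : nat) (S : 'M[R]_n) : Prop :=
  forall x : 'cV[R]_n, x != 0 -> 0 < (x^T *m S *m x) 0 0.

Definition spdmx (R : realFieldType) (n : nat) (S : 'M[R]_n) : Prop :=
  S^T = S /\ posdefmx S.

(* Elimination of the second block variable of (E F ; F' G) (p ; eta) = (b ; c):
   the reduced system is (E - F G^-1 F') p = b - F G^-1 c.  In the symmetric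
   case F' = F^T.  Since [invmx] is total, statements using these definitions
   must assert [drsubmx X \in unitmx]. *)
Definition schur_compl (R : realFieldType) (n r : nat) (X : 'M[R]_(n + r)) :
    'M[R]_n :=
  ulsubmx X - ursubmx X *m invmx (drsubmx X) *m dlsubmx X.

Definition schur_rhs (R : realFieldType) (n r : nat) (X : 'M[R]_(n + r))
    (b : 'cV[R]_(n + r)) : 'cV[R]_n :=
  usubmx b - ursubmx X *m invmx (drsubmx X) *m dsubmx b.

(* Omega is 'I_(\sum_i n_ i), with n_ i = |Omega_i|: the subdomains are
   consecutive ranges of indices, k lies in the subdomain of index
   [tagnat.sig1 k], and A_ij is [submxblock A i j]. *)

Definition neighbor (R : realFieldType) (m : nat) (n_ : 'I_m -> nat)
    (A : 'M[R]_(\sum_i n_ i)) (i j : 'I_m) : bool :=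
  (i != j) && (submxblock A i j != 0).

Definition edges (R : realFieldType) (m : nat) (n_ : 'I_m -> nat)
    (A : 'M[R]_(\sum_i n_ i)) :
    {set 'I_(\sum_i n_ i) * 'I_(\sum_i n_ i)} :=
  [set kl | (tagnat.sig1 kl.1 < tagnat.sig1 kl.2)%N & A kl.1 kl.2 != 0].

(* R^E is 'cV_#|E|: the e-th coordinate is that of the edge [enum_val e]. *)
Definition edge (R : realFieldType) (m : nat) (n_ : 'I_m -> nat)
    (A : 'M[R]_(\sum_i n_ i)) (e : 'I_#|edges A|) :
    'I_(\sum_i n_ i) * 'I_(\sum_i n_ i) :=
  enum_val e.

Definition Wmx (R : realFieldType) (m : nat) (n_ : 'I_m -> nat)
    (A : 'M[R]_(\sum_i n_ i)) : 'M[R]_#|edges A| :=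
  diag_mx (\row_e A (edge e).1 (edge e).2).

Definition Mmx (R : realFieldType) (m : nat) (n_ : 'I_m -> nat)
    (A : 'M[R]_(\sum_i n_ i)) : 'M[R]_(#|edges A|, \sum_i n_ i) :=
  \matrix_(e, k) (((k == (edge e).1)%:R + (k == (edge e).2)%:R) / 2).

Lemma MmxE (R : realFieldType) (m : nat) (n_ : 'I_m -> nat)
    (A : 'M[R]_(\sum_i n_ i)) (p : 'cV[R]_(\sum_i n_ i)) (e : 'I_#|edges A|) :
  (Mmx A *m p) e 0 = (p (edge e).1 0 + p (edge e).2 0) / 2.
Proof.
have pick N (q : 'cV[R]_N) (k : 'I_N) : \sum_j (j == k)%:R * q j 0 = q k 0.
  rewrite (bigD1 k) //= eqxx mul1r big1 ?addr0 // => j /negPf ->.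
  by rewrite mul0r.
rewrite mxE -!pick -big_split mulr_suml /=.
by apply: eq_bigr => k _; rewrite mxE mulrAC mulrDl.
Qed.

Definition Dmx (R : realFieldType) (m : nat) (n_ : 'I_m -> nat)
    (A : 'M[R]_(\sum_i n_ i)) (i j : 'I_m) : 'M[R]_(n_ i) :=
  diag_mx (submxblock A i j *m const_mx 1 : 'cV_(n_ i))^T.

Definition Asub (R : realFieldType) (m : nat) (n_ : 'I_m -> nat)
    (A : 'M[R]_(\sum_i n_ i)) (i : 'I_m) : 'M[R]_(n_ i) :=
  submxblock A i i - \sum_(j | neighbor A j i) Dmx A i j.

Definition Ahat (R : realFieldType) (m : nat) (n_ : 'I_m -> nat)
    (A : 'M[R]_(\sum_i n_ i)) : 'M[R]_(\sum_i n_ i) :=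
  \mxdiag_i Asub A i.

Definition Qmx (R : realFieldType) (m : nat) (n_ : 'I_m -> nat)
    (A : 'M[R]_(\sum_i n_ i)) (r : nat) (Z : 'M[R]_(#|edges A|, r)) :
    'M[R]_(\sum_i n_ i + r) :=
  block_mx (4^-1 *: Ahat A)             ((Mmx A)^T *m Wmx A *m Z)
           (Z^T *m Wmx A *m Mmx A)      (- (Z^T *m Wmx A *m Z)).

Definition reduced_mx (R : realFieldType) (m : nat) (n_ : 'I_m -> nat)
    (A : 'M[R]_(\sum_i n_ i)) (r : nat) (Z : 'M[R]_(#|edges A|, r)) :
    'M[R]_(\sum_i n_ i) :=
  Ahat A + 4 *: ((Mmx A)^T *m Wmx A *m Z *m invmx (Z^T *m Wmx A *m Z)
                   *m Z^T *m Wmx A *m Mmx A).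

(* Main.v *)
(* Expanding the block structure gives [Ahat A = A - 4 M^T W M].  With B = - W
   and G = Z^T B Z, the reduced matrix is therefore
   [A + 4 M^T (B - B Z G^-1 Z^T B) M], and the bracket equals [P^T B P] for
   [P = 1 - Z G^-1 Z^T B], so it is positive semidefinite. *)
Require Import Defs.
From HB Require Import structures.
From mathcomp Require Import all_boot all_order all_algebra.
From mathcomp Require Import ring.
Import Order.TTheory GRing.Theory Num.Theory.
Local Open Scope ring_scope.

Lemma posdefmx_ge0 (R : realFieldType) (n : nat) (S : 'M[R]_n) (x : 'cV[R]_n) :
  posdefmx S -> 0 <= (x^T *m S *m x) 0 0.
Proof.
move=> posS; have [->|/posS/ltW //] := eqVneq x 0.
by rewrite mulmx0 mxE.
Qed.

Lemma posdefmx_unit (R : realFieldType) (n : nat) (S : 'M[R]_n) :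
  posdefmx S -> S \in unitmx.
Proof.
move=> posS; rewrite -row_free_unit; apply: inj_row_free => v vS0.
apply/eqP/negPn/negP => v_neq0.
have /posS : v^T != 0 by rewrite -(inj_eq trmx_inj) trmxK trmx0.
by rewrite trmxK vS0 mul0mx mxE ltxx.
Qed.

Lemma spdmx_congr (R : realFieldType) (n r : nat) (S : 'M[R]_n)
    (Z : 'M[R]_(n, r)) :
  (forall x : 'cV[R]_r, Z *m x = 0 -> x = 0) -> spdmx S ->
  spdmx (Z^T *m S *m Z).
Proof.
move=> Zinj [symS posS]; split=> [|x x_neq0].
  by rewrite !trmx_mul trmxK symS mulmxA.
suff /posS: Z *m x != 0 by rewrite trmx_mul !mulmxA.
by apply: contra_neq x_neq0 => /Zinj.
Qed.

Lemma posdefmxZ (R : realFieldType) (n : nat) (a : R) (S : 'M[R]_n) :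
  0 < a -> posdefmx S -> posdefmx (a *: S).
Proof.
by move=> a0 posS x /posS xSx; rewrite -scalemxAr -scalemxAl mxE pmulr_rgt0.
Qed.

Lemma invmxN (R : comUnitRingType) (n : nat) (S : 'M[R]_n) :
  S \in unitmx -> invmx (- S) = - invmx S.
Proof.
move=> uS; rewrite -[- S]scaleN1r invmxZ ?unitmxZ ?unitrN1 //.
by rewrite invrN1 scaleN1r.
Qed.

(** Rank-nullity: the image of [Z] has dimension [r], which is also its number of columns, so
    nothing is left for the kernel. *)
Lemma range_basis_inj (F : fieldType) (n r : nat) (L : {vspace 'cV[F]_n})
    (Z : 'M[F]_(n, r)) :
  \dim L = r ->
  (forall v : 'cV[F]_n, v \in L <-> exists x : 'cV[F]_r, v = Z *m x) ->
  forall x : 'cV[F]_r, Z *m x = 0 -> x = 0.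
Proof.
move=> dimL rangeZ x Zx0.
pose f : 'Hom('cV[F]_r, 'cV[F]_n) := linfun (mulmx Z).
have imf : (f @: fullv)%VS = L.
  apply/vspaceP => v; apply/memv_imgP/idP => [[y _ ->]|/rangeZ[y ->]].
    by apply/rangeZ; exists y; rewrite lfunE.
  by exists y; rewrite ?memvf ?lfunE.
have := limg_ker_dim f fullv; rewrite imf dimL capfv dimvf /dim /= muln1.
move=> /eqP; rewrite -[X in _ == X]add0n eqn_add2r dimv_eq0 => /eqP kerf0.
by apply/eqP; rewrite -memv0 -kerf0 memv_ker lfunE /= Zx0.
Qed.

Lemma sum_indicator (R : pzRingType) (I : finType) (k : I) (F : I -> R) :
  \sum_i (k == i)%:R * F i = F k.
Proof.
rewrite (bigD1 k) //= eqxx mul1r big1 ?addr0 // => i.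
by rewrite eq_sym => /negPf->; rewrite mul0r.
Qed.

Lemma sum_sig1 (R : pzRingType) (m : nat) (n_ : 'I_m -> nat)
    (P : pred 'I_m) (F : 'I_(\sum_i n_ i) -> R) :
  \sum_(k | P (tagnat.sig1 k)) F k =
  \sum_(i | P i) \sum_(a < n_ i) F (tagnat.Rank i a).
Proof.
rewrite big_mkcond /= [RHS]big_mkcond /=.
(* Pushing the condition into the inner sum makes both sums unconditional, so the double sum
   reindexes along the bijection between global indices and pairs (subdomain, local index). *)
under [RHS]eq_bigr => i _.
  rewrite (_ : (if _ then _ else _) =
    \sum_(a < n_ i) (if P i then F (tagnat.Rank i a) else 0)); last first.
    by case: ifP; rewrite // big1.
  over.
rewrite sig_big_dep (reindex _ tagnat.sig_bij_on) /=.
by apply: eq_bigr => k _; rewrite -[in LHS](tagnat.sig2K k) tagnat.Rank1K.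
Qed.

(* The condition [a_kl != 0] defining edges can be dropped, as the summand
   vanishes on the pairs it excludes. *)
Lemma MtWM_sum (R : realFieldType) (m : nat) (n_ : 'I_m -> nat)
    (A : 'M[R]_(\sum_i n_ i)) (k l : 'I_(\sum_i n_ i)) :
  4 * ((Mmx A)^T *m Wmx A *m Mmx A) k l =
  \sum_i \sum_j (tagnat.sig1 i < tagnat.sig1 j)%:R * A i j *
     ((k == i)%:R + (k == j)%:R) * ((l == i)%:R + (l == j)%:R).
Proof.
pose F (e : 'I_(\sum_i n_ i) * 'I_(\sum_i n_ i)) : R :=
  A e.1 e.2 * ((k == e.1)%:R + (k == e.2)%:R) *
              ((l == e.1)%:R + (l == e.2)%:R).
have -> : 4 * ((Mmx A)^T *m Wmx A *m Mmx A) k l = \sum_(e in edges A) F e.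
  rewrite (big_enum_val F) -mulmxA mxE mulr_sumr; apply: eq_bigr => e _.
  by rewrite mul_diag_mx !mxE /F /edge; field.
rewrite pair_bigA /= big_mkcond /=; apply: eq_bigr => -[i j] _ /=.
rewrite inE /F /=; case: ltnP => _ /=; last by rewrite !mul0r.
by case: eqP => [->|_] /=; rewrite ?mul1r ?mul0r.
Qed.

(** An edge (i, j) adds a_ij at the four positions (i, i), (j, j), (i, j) and (j, i). The last two
    rebuild the off-diagonal blocks of [A]; the first two accumulate, on the diagonal, the row sums
    over the other subdomains. *)
Lemma MtWM_entry (R : realFieldType) (m : nat) (n_ : 'I_m -> nat)
    (A : 'M[R]_(\sum_i n_ i)) (k l : 'I_(\sum_i n_ i)) :
  A^T = A ->
  4 * ((Mmx A)^T *m Wmx A *m Mmx A) k l =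
  (k == l)%:R * (\sum_(j | tagnat.sig1 j != tagnat.sig1 k) A k j) +
  (tagnat.sig1 k != tagnat.sig1 l)%:R * A k l.
Proof.
move=> symA; have Asym i j : A i j = A j i by rewrite -{1}symA mxE.
(* [s] is the strictly block upper triangular part of [A]; by symmetry of [A], adding its transpose
   restores all off-diagonal blocks. *)
pose s (i j : 'I_(\sum_i n_ i)) : R :=
  (tagnat.sig1 i < tagnat.sig1 j)%:R * A i j.
have sE i j : s i j + s j i = (tagnat.sig1 j != tagnat.sig1 i)%:R * A i j.
  by rewrite /s (Asym j i) -mulrDl -(inj_eq val_inj); case: ltngtP;
    rewrite ?addr0 ?add0r.
have -> : 4 * ((Mmx A)^T *m Wmx A *m Mmx A) k l =
    (l == k)%:R * \sum_j s k j + (l == k)%:R * \sum_i s i k + (s k l + s l k).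
  rewrite MtWM_sum.
  (* The four products of indicators, each arranged so that [sum_indicator] can collapse it. *)
  transitivity (\sum_i (k == i)%:R * \sum_j s i j * (l == i)%:R
    + \sum_i \sum_j (k == j)%:R * (s i j * (l == j)%:R)
    + (\sum_i (k == i)%:R * \sum_j (l == j)%:R * s i j
    + \sum_i (l == i)%:R * \sum_j (k == j)%:R * s i j)).
    rewrite -!big_split; apply: eq_bigr => i _ /=.
    rewrite !mulr_sumr -!big_split; apply: eq_bigr => j _ /=.
    by rewrite /s; ring.
  rewrite !sum_indicator -mulr_suml.
  under [X in _ + X + _]eq_bigr do rewrite sum_indicator.
  by rewrite -mulr_suml [X in X + _ + _]mulrC [X in _ + X + _]mulrC.
rewrite sE -mulrDr -big_split /= eq_sym [in X in _ + X]eq_sym; congr (_ * _ + _).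
by rewrite [RHS]big_mkcond; apply: eq_bigr => j _; rewrite sE;
  case: eqP; rewrite ?mul0r ?mul1r.
Qed.

(** By [MtWM_entry], the subtraction cancels the off-diagonal blocks of [A], and in the i-th
    diagonal block it removes the row sums collected in the matrices D_ij. *)
Lemma AhatE (R : realFieldType) (m : nat) (n_ : 'I_m -> nat)
    (A : 'M[R]_(\sum_i n_ i)) :
  A^T = A -> Ahat A = A - 4 *: ((Mmx A)^T *m Wmx A *m Mmx A).
Proof.
move=> symA; have := MtWM_entry _ _ _ _ _ _ symA.
move: (_ *m Mmx A) => X XE; rewrite -[RHS]submxblockK; apply/eq_mxblockP => i j.
apply/matrixP => a b; rewrite !mxE XE !tagnat.Rank1K.
have [eq_ij|neq_ij] := eqVneq i j; last first.
  rewrite [tagnat.Rank _ _ == _](_ : _ = false) ?mul0r ?mul1r ?add0r ?subrr ?mxE //.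
  by apply/eqP => /(congr1 tagnat.sig1); rewrite !tagnat.Rank1K; apply/eqP.
case: j / eq_ij b => b.
rewrite conform_mx_id !mxE summxE mul0r addr0.
rewrite {1}/tagnat.Rank (inj_eq tagnat.rank_inj) eq_Tagged /=.
congr (_ - _).
rewrite (sum_sig1 _ _ _ (fun j => j != i)) mulr_sumr big_mkcond [RHS]big_mkcond /=.
apply: eq_bigr => j _; rewrite /neighbor.
case: (j != i) => //=; case: eqP => [A0|_] /=.
  (* [neighbor A j i] tests the block A_ji, whereas the row sum runs over A_ij; symmetry of [A]
     transfers the vanishing. *)
  rewrite big1 ?mulr0 // => c _.
  by move/matrixP: A0 => /(_ c a); rewrite -{1}symA !mxE.
rewrite !mxE mulrC mulr_natr; congr (_ *+ _).
by apply: eq_bigr => c _; rewrite !mxE mulr1.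
Qed.

(** [P] is the projector along the range of [Z] with Z^T S P = 0. Hence the correction term of P^T
    dies against S P, leaving P^T S P = S P. *)
Lemma deflation_congr (R : comUnitRingType) (n r : nat) (S : 'M[R]_n)
    (Z : 'M[R]_(n, r)) :
  let G := Z^T *m S *m Z in
  let P := 1%:M - Z *m invmx G *m Z^T *m S in
  S^T = S -> G \in unitmx ->
  P^T *m S *m P = S - S *m Z *m invmx G *m Z^T *m S.
Proof.
move=> G P symS uG.
have symG : G^T = G by rewrite !trmx_mul trmxK symS mulmxA.
have ZtSP : Z^T *m (S *m P) = 0.
  by rewrite mulmxA mulmxBr mulmx1 !mulmxA mulmxV // mul1mx subrr.
have -> : P^T = 1%:M - S *m Z *m invmx G *m Z^T.
  by rewrite linearB /= trmx1 !trmx_mul trmxK symS trmx_inv symG !mulmxA.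
rewrite !mulmxBl mul1mx -!mulmxA ZtSP !mulmx0 subr0.
by rewrite mulmxBr mulmx1 !mulmxA.
Qed.

Lemma reduced_mxE (R : realFieldType) (m : nat) (n_ : 'I_m -> nat)
    (A : 'M[R]_(\sum_i n_ i)) (r : nat) (Z : 'M[R]_(#|edges A|, r)) :
  A^T = A -> Z^T *m Wmx A *m Z \in unitmx ->
  exists C, reduced_mx Z = A + 4 *: (C^T *m (- Wmx A) *m C).
Proof.
move=> symA uG.
(* The witness is P M. The projector P is the same for W and -W, so [deflation_congr] is applied to
   W and the sign is pulled out. *)
exists ((1%:M - Z *m invmx (Z^T *m Wmx A *m Z) *m Z^T *m Wmx A) *m Mmx A).
rewrite trmx_mul mulmxN mulNmx -[(Mmx A)^T *m _ *m _]mulmxA mulmxA.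
rewrite -[(Mmx A)^T *m _ *m _]mulmxA deflation_congr ?tr_diag_mx //.
rewrite /reduced_mx AhatE // mulmxBr mulmxBl opprB scalerBr addrA addrAC.
by rewrite !mulmxA.
Qed.

Lemma schur_elimination (R : realFieldType) (n r : nat) (X : 'M[R]_(n + r))
    (b : 'cV[R]_(n + r)) (p : 'cV[R]_n) :
  drsubmx X \in unitmx ->
  (exists eta : 'cV[R]_r, X *m col_mx p eta = b) <->
  schur_compl X *m p = schur_rhs X b.
Proof.
move=> uG; rewrite /schur_compl /schur_rhs -{1}[X]submxK -{1}[b]vsubmxK.
move: uG (ulsubmx X) (ursubmx X) (dlsubmx X) (usubmx b) (dsubmx b).
move: (drsubmx X) => G uG E F F' b1 b2.
rewrite mulmxBl -!mulmxA; split=> [[eta]|schur_eq].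
  rewrite mul_block_col => /eq_col_mx[<- <-].
  by rewrite mulmxDr mulKmx // mulmxDr opprD addrACA subrr addr0.
(* This [eta] is the solution of the second block row for the given [p]. *)
exists (invmx G *m (b2 - F' *m p)).
rewrite mul_block_col mulKVmx // [F' *m p + _]addrC subrK; congr col_mx.
apply: (addIr (- (F *m (invmx G *m b2)))).
by rewrite -schur_eq !mulmxBr [X in _ + X - _]addrC addrA addrK.
Qed.

Theorem corollary5p1 (R : realFieldType) (m : nat) (n_ : 'I_m -> nat)
    (A : 'M[R]_(\sum_i n_ i)) (r : nat)
    (Lambda : {vspace 'cV[R]_#|edges A|}) (Z : 'M[R]_(#|edges A|, r))
    (hA : spdmx A) (hW : spdmx (- Wmx A))
    (hr : \dim Lambda = r)
    (hZ : forall v : 'cV[R]_#|edges A|,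
        v \in Lambda <-> exists x : 'cV[R]_r, v = Z *m x) :
  (drsubmx (Qmx Z) \in unitmx /\ posdefmx (schur_compl (Qmx Z))) /\
  (Z^T *m Wmx A *m Z \in unitmx /\
   forall f p : 'cV[R]_(\sum_i n_ i),
     ((exists eta : 'cV[R]_r,
         Qmx Z *m col_mx p eta = col_mx (4^-1 *: f) 0) <->
      schur_compl (Qmx Z) *m p = schur_rhs (Qmx Z) (col_mx (4^-1 *: f) 0)) /\
     (schur_compl (Qmx Z) *m p = schur_rhs (Qmx Z) (col_mx (4^-1 *: f) 0) <->
      reduced_mx Z *m p = f)) /\
  spdmx (reduced_mx Z).
Proof.
have [symA posA] := hA; pose G := Z^T *m Wmx A *m Z.
have spdG : spdmx (- G).
  rewrite -mulNmx -mulmxN; apply: spdmx_congr hW.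
  exact: range_basis_inj hr hZ.
have uNG : - G \in unitmx by apply: posdefmx_unit; case: spdG.
have uG : G \in unitmx by rewrite -[G]opprK -scaleN1r unitmxZ ?unitrN1.
have spdM : spdmx (reduced_mx Z).
  have [C ->] := reduced_mxE _ _ _ _ _ _ symA uG.
  have [symW posW] := hW.
  split=> [|x x_neq0].
    by rewrite linearD linearZ /= !trmx_mul trmxK symW symA mulmxA.
  (* Strictness comes from [A] alone; the congruence term is only semidefinite, since [C] may have a
     kernel. *)
  rewrite mulmxDr mulmxDl mxE ltr_wpDr ?posA //.
  rewrite -scalemxAr -scalemxAl mxE mulr_ge0 //.
  by have := posdefmx_ge0 _ _ _ (C *m x) posW; rewrite trmx_mul !mulmxA.
(* The minus sign of the Schur complement cancels against that of the lower right block -G. *)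
have redE : schur_compl (Qmx Z) = 4^-1 *: reduced_mx Z.
  rewrite /schur_compl block_mxKul block_mxKur block_mxKdl block_mxKdr.
  rewrite invmxN // /reduced_mx scalerDr scalerA mulVf ?pnatr_eq0 // scale1r.
  by rewrite mulmxN mulNmx opprK !mulmxA.
have quarter_neq0 : 4^-1 != 0 :> R by rewrite invr_eq0 pnatr_eq0.
have uQ : drsubmx (Qmx Z) \in unitmx by rewrite block_mxKdr.
split; last split=> //.
  split=> //; rewrite redE; apply: posdefmxZ; last by case: spdM.
  by rewrite invr_gt0 ltr0n.
split=> // f p; split; first exact: schur_elimination.
(* The second block of the right-hand side is 0, so both sides carry just the factor 1/4, which is
   then cancelled. *)
rewrite redE /schur_rhs col_mxKu col_mxKd mulmx0 subr0 -scalemxAl.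
by split=> [/(scalerI quarter_neq0)|->].
Qed.
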